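(* Let $\Phi=\phi_1\wedge\cdots\wedge\phi_m$ be an extremal instance over variables $\mathbf X=(X_1,\dots,X_n)$ with product distribution $\mathcal D$, and suppose $\Phi$ is satisfiable, i.e. $\Pr_{\mathcal D}(\Phi(\mathbf X))>0$. Then $\mathrm{PRS}(\Phi,\mathcal D)$ terminates with probability $1$, whatever rule is used to choose the false clause in each iteration. On termination, $\mathbf X$ is distributed according to $\mathcal D_\Phi$, the distribution $\mathcal D$ conditioned on $\Phi(\mathbf X)$ being true.
   Context: Setting: For $i\in[n]$, $X_i$ takes values in a countable set $D_i$ equipped with a probability distribution $\mathcal D_i$; $\mathcal D=\mathcal D_1\times\cdots\times\mathcal D_n$ is the product distribution. A formula $\Phi=\phi_1\wedge\cdots\wedge\phi_m$ is a conjunction of clauses. Each clause $\phi_k$ is a Boolean function of the variables $X_i$ with $i\in\mathrm{Scp}(\phi_k)$, where $\mathrm{Scp}(\phi_k)\subseteq[n]$ is a nonempty set called the scope of $\phi_k$. The instance $\Phi$ is extremal if for all $1\le k<\ell\le m$ with $\mathrm{Scp}(\phi_k)\cap\mathrm{Scp}(\phi_\ell)\neq\emptyset$, the formula $\phi_k\vee\phi_\ell$ is true under every assignment, i.e. two clauses sharing a variable are never simultaneously false. Algorithm $\mathrm{PRS}(\Phi,\mathcal D)$ (Partial Rejection Sampling): sample $\mathbf X$ from $\mathcal D$. While $\Phi(\mathbf X)$ is false, choose any clause $\phi_k$ that is false under the current $\mathbf X$ and resample all variables $X_i$, $i\in\mathrm{Scp}(\phi_k)$, independently from their distributions $\mathcal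 D_i$. The choice of the false clause may be made by an arbitrary rule; it may depend on the current values, the past history, or independent external randomness. Each execution of the loop body is one iteration. *)

(* Defs.v *)
From HB Require Import structures.
From mathcomp Require Import all_boot all_order all_algebra.
From mathcomp Require Import all_classical all_reals all_analysis.
Set Implicit Arguments. Unset Strict Implicit. Unset Printing Implicit Defensive.
Import Order.TTheory GRing.Theory Num.Theory.
Local Open Scope classical_set_scope.
Local Open Scope ring_scope.

Definition assign (n : nat) (T : 'I_n -> countType) : countType :=
  {dffun forall i : 'I_n, T i}.

Definition is_pmf (R : realType) (U : countType) (q : U -> R) : Prop :=
  (forall u, 0 <= q u) /\ (\esum_(u in [set: U]) (q u)%:E = 1)%E.

Definition prodD (R : realType) n (T : 'I_n -> countType)
  (p : forall i, T i -> R) (x : assign T) : R :=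
  \prod_(i < n) p i (x i).

Definition Phi n (T : 'I_n -> countType) m (phi : 'I_m -> assign T -> bool)
  (x : assign T) : bool := [forall k, phi k x].

Definition well_scoped n (T : 'I_n -> countType) m
  (phi : 'I_m -> assign T -> bool) (scp : 'I_m -> {set 'I_n}) : Prop :=
  (forall k, scp k != finset.set0) /\
  (forall k (x y : assign T), (forall i, i \in scp k -> x i = y i) -> phi k x = phi k y).

Definition extremal n (T : 'I_n -> countType) m
  (phi : 'I_m -> assign T -> bool) (scp : 'I_m -> {set 'I_n}) : Prop :=
  forall k l : 'I_m, (k < l)%N -> scp k :&: scp l != finset.set0 ->
    forall x : assign T, phi k x || phi l x.

Definition probPhi (R : realType) n (T : 'I_n -> countType)
  (p : forall i, T i -> R) m (phi : 'I_m -> assign T -> bool) : \bar R :=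
  \esum_(x in [set x : assign T | Phi phi x]) (prodD p x)%:E.

Definition condD (R : realType) n (T : 'I_n -> countType)
  (p : forall i, T i -> R) m (phi : 'I_m -> assign T -> bool) (x : assign T) : R :=
  prodD p x * (Phi phi x)%:R / fine (probPhi p phi).

(* ---------- Partial Rejection Sampling as a stochastic process ----------
   A finite history of PRS is a pair (x0, s): x0 is the initial sample and
   s = [:: (k_t, x_t); ...; (k_1, x_1)] lists, MOST RECENT FIRST, the clause
   k_j resampled in iteration j and the resulting assignment x_j. *)
Definition history n (T : 'I_n -> countType) m : countType :=
  (assign T * seq ('I_m * assign T))%type.

Definition cur n (T : 'I_n -> countType) m (x0 : assign T)
  (s : seq ('I_m * assign T)) : assign T :=
  if s is (_, y) :: _ then y else x0.

(* The selection rule: given the history so far, a probability distribution on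
   the clause to resample (this covers deterministic rules, rules depending on
   current values / past history, and rules using independent external
   randomness). It must only pick clauses that are false in the current state. *)
Definition valid_rule (R : realType) n (T : 'I_n -> countType) m
  (phi : 'I_m -> assign T -> bool)
  (sel : assign T -> seq ('I_m * assign T) -> 'I_m -> R) : Prop :=
  (forall x0 s k, 0 <= sel x0 s k) /\
  (forall x0 s, ~~ Phi phi (cur x0 s) -> \sum_(k < m) sel x0 s k = 1) /\
  (forall x0 s k, phi k (cur x0 s) -> sel x0 s k = 0).

Definition resample (R : realType) n (T : 'I_n -> countType)
  (p : forall i, T i -> R) (A : {set 'I_n}) (x y : assign T) : R :=
  (([forall i, (i \notin A) ==> (y i == x i)])%:R *
   \prod_(i < n | i \in A) p i (y i))%R.

Fixpoint histw (R : realType) n (T : 'I_n -> countType)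
  (p : forall i, T i -> R) m (phi : 'I_m -> assign T -> bool)
  (scp : 'I_m -> {set 'I_n})
  (sel : assign T -> seq ('I_m * assign T) -> 'I_m -> R)
  (x0 : assign T) (s : seq ('I_m * assign T)) : R :=
  match s with
  | [::] => prodD p x0
  | (k, y) :: s' =>
      histw p phi scp sel x0 s' *
      ((~~ Phi phi (cur x0 s'))%:R * sel x0 s' k * resample p (scp k) (cur x0 s') y)
  end.

Definition termProb (R : realType) n (T : 'I_n -> countType)
  (p : forall i, T i -> R) m (phi : 'I_m -> assign T -> bool)
  (scp : 'I_m -> {set 'I_n})
  (sel : assign T -> seq ('I_m * assign T) -> 'I_m -> R)
  (x : assign T) : \bar R :=
  \esum_(h in [set h : history T m | Phi phi (cur h.1 h.2) /\ cur h.1 h.2 = x])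
     (histw p phi scp sel h.1 h.2)%:E.

Definition haltProb (R : realType) n (T : 'I_n -> countType)
  (p : forall i, T i -> R) m (phi : 'I_m -> assign T -> bool)
  (scp : 'I_m -> {set 'I_n})
  (sel : assign T -> seq ('I_m * assign T) -> 'I_m -> R) : \bar R :=
  \esum_(h in [set h : history T m | Phi phi (cur h.1 h.2)])
     (histw p phi scp sel h.1 h.2)%:E.

(* Main.v *)
Require Import Defs.
From HB Require Import structures.
From mathcomp Require Import all_boot all_order all_algebra.
From mathcomp Require Import all_classical all_reals all_analysis.
Import Order.TTheory GRing.Theory Num.Theory.
Local Open Scope classical_set_scope.
Local Open Scope ring_scope.

(* Two distinct clauses that are false at the same time have disjoint scopes, so
   their resamplings commute and the joint law of the number of resamplings and
   of the final assignment does not depend on the rule.  It may thus be computed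
   for the rule choosing the first false clause.  For it, conditionally on the
   log of resampled clauses, the current assignment always follows D
   conditioned on some set G of clauses: the choice of clause k adds the clauses
   before k to G, and resampling k removes those whose scope meets that of k,
   without affecting the others.  Hence the final assignment follows D_Phi
   whatever the log.  Termination holds because, from any assignment,
   resampling false clauses to the values of a fixed satisfying assignment of
   positive weight satisfies Phi in at most n steps. *)

(** * Sums of nonnegative extended reals *)

Section Esum.
Context {R : realType}.
Implicit Types (T : choiceType).
Local Open Scope ereal_scope.

Lemma esum_ge_term {T} (I : set T) (a : T -> \bar R) (t : T) :
  (forall i, I i -> 0 <= a i) -> I t -> a t <= \esum_(i in I) a i.
Proof.
move=> a0 It; apply: esum_ge; exists [set t].
  by split => // _ ->.
by rewrite fsbig_set1.
Qed.

Lemma esumZl {T} (I : set T) (c : \bar R) (a : T -> \bar R) :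
  0 <= c -> (forall i, I i -> 0 <= a i) ->
  \esum_(i in I) (c * a i) = c * \esum_(i in I) a i.
Proof.
move=> c0 a0.
have le (b : R) (f : T -> \bar R) : (0 < b)%R -> (forall i, I i -> 0 <= f i) ->
    \esum_(i in I) (b%:E * f i) <= b%:E * \esum_(i in I) f i.
  move=> b0 f0; apply: ge_ereal_sup => _ [X [finX XI] <-].
  rewrite fsbig_finite//= big_seq -ge0_sume_distrr -?big_seq; last first.
    by move=> i; rewrite in_fset_set// inE => /XI /f0.
  rewrite lee_pmul2l// -fsbig_finite//; apply: ereal_sup_ubound.
  by exists X.
case: c c0 => [c c0| _ |//].
- have [->|cn0] := eqVneq c 0%R.
    by rewrite mul0e; apply: esum1 => i _; rewrite mul0e.
  have {cn0}cp : (0 < c)%R by rewrite lt_neqAle eq_sym cn0.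
  (* The reverse inequality is the bound [le] for the factor [c^-1] and the terms [c * a i]. *)
  apply/eqP; rewrite eq_le le//= -lee_pdivlMl//.
  have := le c^-1%R (fun i => c%:E * a i).
  rewrite invr_gt0 => /(_ cp).
  under eq_esum => i Ii do rewrite muleA -EFinM mulVf ?gt_eqF// mul1e.
  by apply=> i Ii; rewrite mule_ge0// a0.
- have [s0|sn0] := eqVneq (\esum_(i in I) a i) 0.
    rewrite s0 mule0; apply: esum1 => i Ii.
    suff -> : a i = 0 by rewrite mule0.
    by apply/eqP; rewrite eq_le a0// andbT -s0 esum_ge_term.
  have sp : 0 < \esum_(i in I) a i by rewrite lt_neqAle eq_sym sn0 esum_ge0.
  rewrite gt0_mulye//; apply/eqP; rewrite -leye_eq.
  have [t It at0] : exists2 t, I t & a t != 0.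
    apply: contrapT => h; move/eqP: sn0; apply; apply: esum1 => i Ii.
    by apply: contrapT => /eqP ai; apply: h; exists i.
  apply: le_trans (esum_ge_term I (fun i => +oo * a i) t _ It).
    by rewrite gt0_mulye// lt_neqAle eq_sym at0 a0.
  by move=> i Ii; rewrite mule_ge0// a0.
Qed.

Lemma exchange_esum {T T' : choiceType} (I : set T) (J : set T')
    (a : T -> T' -> \bar R) :
  (forall i j, 0 <= a i j) ->
  \esum_(i in I) \esum_(j in J) a i j = \esum_(j in J) \esum_(i in I) a i j.
Proof.
move=> a0; rewrite (@esum_esum _ _ _ I (fun=> J))//.
rewrite (@esum_esum _ _ _ J (fun=> I) (fun j i => a i j))//.
apply: (reindex_esum _ _ (fun k => (k.2, k.1))); split => //=.
- by move=> [j i] [].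
- by move=> [j i] [j' i'] _ _ /= [-> ->].
- by move=> [i j] [/= Ii Jj]; exists (j, i).
Qed.

End Esum.

(** * Assignments and replacement of a block of coordinates *)

Section Assignments.
Context {n : nat} {T : 'I_n -> countType}.
Implicit Types (x y w : assign T) (A B : {set 'I_n}).

(** State after resampling [A] in [x]: a full fresh sample [w] is drawn and only its coordinates in
    [A] are used, so that resampling becomes an expectation under the product law. *)
Definition mix A x w : assign T :=
  [ffun i => if i \in A then w i else x i] : {dffun forall i, T i}.

Lemma mixE A x w i : mix A x w i = if i \in A then w i else x i.
Proof. by rewrite /mix ffunE. Qed.

Lemma assignP x y : (forall i, x i = y i) -> x = y.
Proof. by move=> xy; apply/ffunP. Qed.

Definition box A x : set (assign T) :=
  [set y | forall i, i \notin A -> y i = x i].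

Definition set_coord x i (v : T i) : assign T :=
  [ffun j => eqtype.dfwith (fun k => x k) v j] : {dffun forall i, T i}.

Lemma set_coord_in x i (v : T i) : set_coord x i v i = v.
Proof. by rewrite /set_coord ffunE dfwith_in. Qed.

Lemma set_coord_out x i (v : T i) j : j != i -> set_coord x i v j = x j.
Proof. by move=> ji; rewrite /set_coord ffunE dfwith_out// eq_sym. Qed.

(** Induction on the size of [A]: singling out a coordinate [j] of [A] turns the box into a product
    of [T j] and a smaller box. *)
Lemma esum_box_prod {R : realType} (F : forall i, T i -> \bar R) A x :
  (forall i v, 0 <= F i v)%E ->
  (\esum_(y in box A x) \prod_(i in A) F i (y i) =
   \prod_(i in A) \esum_(v in [set: T i]) F i v)%E.
Proof.
move=> F0; have [k] := ubnP #|A|; elim: k A => // k IH A.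
rewrite ltnS => Ak; case: (set_0Vmem A) => [->|[j jA]].
  rewrite (_ : box _ x = [set x]).
    by rewrite esum_set1 !big_set0.
  apply/seteqP; split => [y /= yx|_ ->] //.
  by apply: assignP => i; apply: yx; rewrite inE.
rewrite (big_setD1 j)//= -IH; last first.
  by move: Ak; rewrite (cardsD1 j) jA.
have P0 (y : assign T) (B : {set 'I_n}) : (0 <= \prod_(i in B) F i (y i))%E.
  by apply: prode_ge0.
rewrite muleC -esumZl ?esum_ge0//.
under [RHS]eq_esum => v _ do rewrite muleC -esumZl//.
rewrite (@esum_esum _ _ _ _ (fun=> box (A :\ j) x))//; last first.
  by move=> *; rewrite mule_ge0.
rewrite (reindex_esum ([set: T j] `*`` (fun=> box (A :\ j) x)) _
    (fun k => set_coord k.2 j k.1)) /=; last first.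
  split => /=.
  - move=> [v y] /= [_ By] i iA.
    have ij : i != j by apply: contraNneq iA => ->.
    by rewrite set_coord_out// By// in_setD1 (negPf iA) andbF.
  - move=> [v y] [v' y']; rewrite !inE /= => -[_ By] [_ By'] e.
    have ev : v = v' by have := congr1 (fun z : assign T => z j) e; rewrite /= !set_coord_in.
    rewrite ev; congr pair; apply: assignP => i.
    have [->|ij] := eqVneq i j; first by rewrite By ?By'// !inE eqxx.
    by have := congr1 (fun z : assign T => z i) e; rewrite /= !set_coord_out.
  (* The smaller box pins coordinate [j] to [x j], so the preimage of [y] resets it. *)
  - move=> y By; exists (y j, set_coord y j (x j)).
      split => //= i; rewrite in_setD1 negb_and negbK => /orP[/eqP ->|iA].
        by rewrite set_coord_in.
      have ij : i != j by apply: contraNneq iA => ->.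
      by rewrite set_coord_out// By.
    apply: assignP => i /=; have [->|ij] := eqVneq i j; first by rewrite set_coord_in.
    by rewrite !set_coord_out.
apply: eq_esum => -[v y] /= _; rewrite (big_setD1 j)//= set_coord_in; congr (_ * _)%E.
by apply: eq_bigr => i; rewrite in_setD1 => /andP[ij _]; rewrite set_coord_out.
Qed.
End Assignments.

(** * Expectation under the product distribution, and resampling *)

Section Expectation.
Context {R : realType} {n : nat} {T : 'I_n -> countType} (p : forall i, T i -> R).
Hypothesis p_pmf : forall i, is_pmf (p i).
Implicit Types (x y w : assign T) (A B : {set 'I_n}) (f g : assign T -> \bar R).
Local Open Scope ereal_scope.

Definition expD f : \bar R := \esum_(w in [set: assign T]) ((prodD p w)%:E * f w).

Let p_ge0 i v : (0 <= p i v)%R. Proof. by case: (p_pmf i). Qed.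

Lemma prodD_ge0 x : (0 <= prodD p x)%R.
Proof. exact: prodr_ge0. Qed.

Let D_ge0 x : 0 <= (prodD p x)%:E.
Proof. by rewrite lee_fin prodD_ge0. Qed.

Lemma eq_expD f g : (forall x, f x = g x) -> expD f = expD g.
Proof. by move=> fg; apply: eq_esum => x _; rewrite fg. Qed.

Lemma expD_ge0 f : (forall x, 0 <= f x) -> 0 <= expD f.
Proof. by move=> f0; apply: esum_ge0 => x _; rewrite mule_ge0. Qed.

Lemma le_expD f g : (forall x, f x <= g x) -> expD f <= expD g.
Proof. by move=> fg; apply: le_esum => x _; rewrite lee_wpmul2l. Qed.

Lemma expDZ (c : \bar R) f : 0 <= c -> (forall x, 0 <= f x) ->
  expD (fun x => c * f x) = c * expD f.
Proof.
move=> c0 f0; rewrite -esumZl//; last by move=> x _; rewrite mule_ge0.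
by apply: eq_esum => x _; rewrite muleCA.
Qed.

Lemma expDD f g : (forall x, 0 <= f x) -> (forall x, 0 <= g x) ->
  expD (fun x => f x + g x) = expD f + expD g.
Proof.
move=> f0 g0; rewrite -esumD//; do ?by move=> x _; rewrite mule_ge0.
by apply: eq_esum => x _; rewrite ge0_muleDr.
Qed.

Lemma expD_sum {I : choiceType} (r : seq I) (P : pred I) (f : I -> assign T -> \bar R) :
  (forall i x, 0 <= f i x) ->
  expD (fun x => \sum_(i <- r | P i) f i x) = \sum_(i <- r | P i) expD (f i).
Proof.
move=> f0; rewrite -esum_sum; last by move=> *; rewrite mule_ge0.
by apply: eq_esum => x _; rewrite ge0_sume_distrr.
Qed.

Lemma expD_esum {I : choiceType} (f : I -> assign T -> \bar R) :
  (forall i x, 0 <= f i x) ->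
  expD (fun x => \esum_(i in [set: I]) f i x) = \esum_(i in [set: I]) expD (f i).
Proof.
move=> f0; rewrite exchange_esum; last by move=> *; rewrite mule_ge0.
by apply: eq_esum => x _; rewrite esumZl.
Qed.

Lemma exchange_expD (f : assign T -> assign T -> \bar R) :
  (forall x y, 0 <= f x y) ->
  expD (fun x => expD (f x)) = expD (fun y => expD (f^~ y)).
Proof.
move=> f0; symmetry.
rewrite [LHS](expD_esum (fun x y => (prodD p x)%:E * f x y)).
  by apply: eq_esum => x _; rewrite expDZ.
by move=> *; rewrite mule_ge0.
Qed.

Lemma prodD_mix A x y :
  prodD p (mix A x y) = (\prod_(i in A) p i (y i) * \prod_(i in ~: A) p i (x i))%R.
Proof.
rewrite /prodD (bigID (mem A)) /=; congr (_ * _)%R.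
  by apply: eq_bigr => i iA; rewrite mixE iA.
by apply: eq_big => [i|i iA]; rewrite ?inE// mixE (negPf iA).
Qed.

(** Exchanging the coordinates in [A] between two independent samples is an involution on pairs that
    preserves the product weight. *)
Lemma expD_swap A (f : assign T -> assign T -> \bar R) :
  (forall x y, 0 <= f x y) ->
  expD (fun x => expD (fun w => f (mix A x w) (mix A w x))) =
  expD (fun x => expD (f x)).
Proof.
move=> f0.
have E (g : assign T -> assign T -> \bar R) : (forall x y, 0 <= g x y) ->
    expD (fun x => expD (g x)) =
    \esum_(k in [set: assign T * assign T])
       ((prodD p k.1 * prodD p k.2)%:E * g k.1 k.2).
  move=> g0; rewrite (_ : [set: _] = [set: assign T] `*`` (fun=> [set: assign T])); last first.
    by apply/seteqP; split.
  rewrite -(@esum_esum _ _ _ setT (fun=> setT)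
    (fun x y => (prodD p x * prodD p y)%:E * g x y)); last first.
    by move=> *; rewrite mule_ge0// lee_fin mulr_ge0 ?prodD_ge0.
  apply: eq_esum => x _; rewrite -esumZl//; last by move=> *; rewrite mule_ge0.
  by apply: eq_esum => y _; rewrite EFinM muleA.
rewrite !E//; symmetry.
have mixK (x w : assign T) : mix A (mix A x w) (mix A w x) = x.
  by apply: assignP => i; rewrite !mixE; case: (i \in A).
rewrite (reindex_esum setT setT (fun k => (mix A k.1 k.2, mix A k.2 k.1))).
  apply: eq_esum => -[x w] _ /=; congr (_%:E * _).
  have mixxx (z : assign T) : mix A z z = z.
    by apply: assignP => i; rewrite mixE if_same.
  transitivity (prodD p (mix A x x) * prodD p (mix A w w))%R; last by rewrite !mixxx.
  rewrite !prodD_mix.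
  by rewrite mulrACA [X in (X * _)%R]mulrC mulrACA.
split => //.
- move=> [x w] [x' w'] _ _ [e1 e2]; congr pair.
    by rewrite -[LHS](mixK x w) e1 e2 mixK.
  by rewrite -[LHS](mixK w x) e1 e2 mixK.
- by move=> [x w] _; exists (mix A x w, mix A w x) => //=; rewrite !mixK.
Qed.

Lemma esum_box_resample A x : (\esum_(y in box A x) (\prod_(i in A) p i (y i))%:E = 1)%E.
Proof.
under eq_esum => y _ do rewrite -prodEFin.
rewrite (esum_box_prod (fun i v => (p i v)%:E))//.
by rewrite big1// => i _; case: (p_pmf i).
Qed.

Lemma assign_inhabited : assign T.
Proof.
have h i : exists v : T i, True.
  apply: contrapT => h; case: (p_pmf i) => _.
  rewrite (_ : [set: T i] = set0) ?esum_set0.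
    by move=> /esym/eqP; rewrite onee_eq0.
  by apply/seteqP; split => // v _; apply: h; exists v.
exact: ([ffun i => projT1 (cid (h i))] : {dffun forall i, T i}).
Qed.

(** Total mass 1 of the product law is the case of [esum_box_resample] where every coordinate is
    resampled. *)
Lemma expD_cst (c : \bar R) : 0 <= c -> expD (fun=> c) = c.
Proof.
move=> c0; rewrite /expD.
under eq_esum => w _ do rewrite muleC.
rewrite esumZl// -[RHS]mule1; congr (_ * _).
rewrite -(esum_box_resample [set: _]%SET assign_inhabited).
rewrite (_ : box _ _ = setT).
  by apply: eq_esum => w _; congr EFin; apply: eq_bigl => i; rewrite inE.
by apply/seteqP; split => // y _ i; rewrite inE.
Qed.

(** Case of [expD_swap] with an integrand ignoring its second argument: the product law is invariant
    under resampling. *)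
Lemma expD_mix A f : (forall x, 0 <= f x) ->
  expD (fun x => expD (fun w => f (mix A x w))) = expD f.
Proof.
move=> f0; rewrite (expD_swap A (fun x _ => f x))//.
by apply: eq_expD => x; rewrite expD_cst.
Qed.

Lemma esum_resample A x f : (forall y, 0 <= f y) ->
  \esum_(y in [set: assign T]) ((resample p A x y)%:E * f y) =
  expD (fun w => f (mix A x w)).
Proof.
move=> f0.
pose P A y := (\prod_(i in A) p i (y i))%R.
have P0 B y : 0 <= (P B y)%:E by rewrite lee_fin prodr_ge0.
transitivity (\esum_(y in box A x) ((P A y)%:E * f y)).
  rewrite esum_mkcond [RHS]esum_mkcond; apply: eq_esum => y _.
  rewrite in_setT /resample; case: forallP => [By|nBy].
    by rewrite mul1r mem_set// => i iA; apply/eqP; have := By i; rewrite iA.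
  rewrite mul0r mul0e memNset// => By; apply: nBy => i.
  by apply/implyP => iA; apply/eqP; exact: By.
(* Inserts the total mass 1 of the coordinates outside [A]; [y] and [z] then glue to one full sample
   [mix A z y]. *)
transitivity (\esum_(y in box A x) \esum_(z in box (~: A) x)
    ((P A y * P (~: A)%SET z)%:E * f y)).
  apply: eq_esum => y _; under eq_esum => z _ do rewrite EFinM muleAC.
  by rewrite esumZl ?mule_ge0// esum_box_resample mule1.
rewrite (@esum_esum _ _ _ (box A x) (fun=> box (~: A) x)
  (fun y z => (P A y * P (~: A)%SET z)%:E * f y)); last first.
  by move=> *; rewrite mule_ge0// EFinM mule_ge0.
symmetry; rewrite /expD (reindex_esum (box A x `*`` (fun=> box (~: A) x)) setT
  (fun k => mix A k.2 k.1)).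
  apply: eq_esum => -[y z] /= [By Bz]; rewrite prodD_mix; congr (_ * f _).
  apply: assignP => i; rewrite !mixE; case: (boolP (i \in A)) => // iA.
  by rewrite By.
split => //.
- move=> [y z] [y' z']; rewrite !inE /= => -[By Bz] [By' Bz'] e.
  have e' i := congr1 (fun w : assign T => w i) e.
  congr pair; apply: assignP => i.
    have := e' i; rewrite /= !mixE; case: (boolP (i \in A)) => // iA.
    by rewrite By ?By'.
  have := e' i; rewrite /= !mixE; case: (boolP (i \in A)) => // iA _.
  by rewrite Bz ?Bz'// inE iA.
- move=> w _; exists (mix A x w, mix A w x).
    split => i /=; first by rewrite mixE => /negPf ->.
    by rewrite inE negbK mixE => ->.
  by apply: assignP => i; rewrite !mixE; case: (i \in A).
Qed.

End Expectation.

(** * The first-false rule: irrelevance of the choice, and law of the final state *)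

Section PartialRejectionSampling.
Context {R : realType} {n m : nat} {T : 'I_n -> countType}.
Variables (p : forall i, T i -> R) (phi : 'I_m -> assign T -> bool).
Variable scp : 'I_m -> {set 'I_n}.
Hypothesis p_pmf : forall i, is_pmf (p i).
Hypothesis phi_scoped : well_scoped phi scp.
Hypothesis phi_extremal : extremal phi scp.
Implicit Types (x y w : assign T) (k l : 'I_m) (f : assign T -> \bar R).
Local Open Scope ereal_scope.

Lemma phi_mix_in k x w : phi k (mix (scp k) x w) = phi k w.
Proof. by apply phi_scoped.2 => i ik; rewrite mixE ik. Qed.

Lemma phi_mix_out (A : {set 'I_n}) l x w :
  A :&: scp l = finset.set0 -> phi l (mix A x w) = phi l x.
Proof.
move=> Al; apply phi_scoped.2 => i il; rewrite mixE ifN//.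
by apply/negP => iA; have := finset.in_set0 i; rewrite -Al inE iA il.
Qed.

(** Contrapositive of extremality, with the order of [k] and [l] removed by symmetry. *)
Lemma disjoint_false_clauses k l x :
  k != l -> ~~ phi k x -> ~~ phi l x -> scp k :&: scp l = finset.set0.
Proof.
wlog kl : k l / (k < l)%N => [hw kl xk xl|_ xk xl].
  have [h|h|/val_inj e] := ltngtP k l; first exact: hw.
    by rewrite finset.setIC hw// eq_sym.
  by rewrite e eqxx in kl.
apply/eqP; apply: contraTT isT => /(phi_extremal _ _ kl)/(_ x).
by rewrite (negPf xk) (negPf xl).
Qed.

Lemma mixC (A B : {set 'I_n}) x w w' : A :&: B = finset.set0 ->
  mix B (mix A x w) w' = mix A (mix B x w') w.
Proof.
move=> AB; apply: assignP => i; rewrite !mixE.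
have := finset.in_set0 i; rewrite -AB inE.
by case: (i \in A); case: (i \in B).
Qed.

Definition first_false k x :=
  ~~ phi k x && [forall l : 'I_m, (l < k)%N ==> phi l x].

Lemma first_false_uniq k l x : first_false k x -> first_false l x = (l == k).
Proof.
move=> /andP[xk /forallP hk]; apply/idP/eqP => [/andP[xl /forallP hl]|->].
  have [h|h|/val_inj //] := ltngtP l k.
    by have := hk l; rewrite h (negPf xl).
  by have := hl k; rewrite h (negPf xk).
by rewrite /first_false xk; apply/forallP.
Qed.

Lemma exists_first_false x : ~~ Phi phi x -> exists k, first_false k x.
Proof.
rewrite negb_forall => /existsP[k0 xk0].
case: (arg_minnP (P := fun k => ~~ phi k x) (fun k => k : nat) xk0) => k xk kmin.
exists k; rewrite /first_false xk; apply/forallP => l; apply/implyP.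
by rewrite ltnNge; apply: contraNT => /kmin.
Qed.

Lemma Phi_false k x : ~~ phi k x -> Phi phi x = false.
Proof. by move=> xk; apply/negbTE; rewrite negb_forall; apply/existsP; exists k. Qed.

(* Expectation of [f] of the final assignment on the event that, started from [x]
   and choosing the first false clause, PRS resamples exactly [t] times. *)
Fixpoint halt_exp (t : nat) f x : \bar R :=
  if t is t'.+1 then
    \sum_(k < m | first_false k x) expD p (fun w => halt_exp t' f (mix (scp k) x w))
  else if Phi phi x then f x else 0.

Lemma halt_exp_ge0 t f x : (forall x, 0 <= f x) -> 0 <= halt_exp t f x.
Proof.
move=> f0; elim: t x => [x|t IH x] /=; first by case: ifP.
by apply: sume_ge0 => k _; apply: expD_ge0.
Qed.

Lemma halt_expS_first k t f x : first_false k x ->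
  halt_exp t.+1 f x = expD p (fun w => halt_exp t f (mix (scp k) x w)).
Proof.
by move=> xk /=; rewrite (big_pred1 k)// => l; rewrite (first_false_uniq _ _ _ xk).
Qed.

Lemma halt_expS_Phi t f x : Phi phi x -> halt_exp t.+1 f x = 0.
Proof.
move=> /forallP xP /=; rewrite big_pred0// => k.
by rewrite /first_false xP.
Qed.

(* Two distinct false clauses have disjoint scopes, so resampling one keeps the
   other false and the two resamplings commute: the choice made by the rule is
   irrelevant. *)
Lemma halt_expS t f k x : (forall x, 0 <= f x) -> ~~ phi k x ->
  halt_exp t.+1 f x = expD p (fun w => halt_exp t f (mix (scp k) x w)).
Proof.
move=> f0; elim: t k x => [|t IH] k x xk.
  all: have [k0 x0] : exists k, first_false k x
    by apply: exists_first_false; rewrite (Phi_false _ _ xk).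
  all: rewrite (halt_expS_first _ _ _ _ x0).
  all: have [->//|kk0] := eqVneq k k0.
  all: have dis := disjoint_false_clauses _ _ _ kk0 xk (andP x0).1.
  all: have dis' : scp k0 :&: scp k = finset.set0 by rewrite finset.setIC.
  (* With no resampling left both sides vanish: [k] stays false after resampling [k0], and
     conversely. *)
  apply: eq_expD => w /=.
  by rewrite (@Phi_false k) ?phi_mix_out// (@Phi_false k0) ?phi_mix_out ?(andP x0).1.
(* By induction [k] may be resampled right after [k0]; the two are exchanged, and induction at [k0]
   reassembles the other side. *)
transitivity (expD p (fun w => expD p (fun w' =>
    halt_exp t f (mix (scp k) (mix (scp k0) x w) w')))).
  by apply: eq_expD => w; rewrite (IH k) ?phi_mix_out.
rewrite exchange_expD//; last by move=> *; apply: halt_exp_ge0.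
apply: eq_expD => w'; rewrite (IH k0) ?phi_mix_out ?(andP x0).1//.
by apply: eq_expD => w; rewrite mixC.
Qed.

Definition holds (G : {set 'I_m}) x := [forall k in G, phi k x].

(** The set of clauses conditioned on after a step that selects and resamples [k], when it was [G]
    before. *)
Definition residual (G : {set 'I_m}) k : {set 'I_m} :=
  [set l | ((l \in G) || (l < k)%N) && (scp k :&: scp l == finset.set0)].

(* Total weight of the logs of [t] resamplings, started from the distribution
   conditioned on the clauses of [G]. *)
Fixpoint log_weight (t : nat) (G : {set 'I_m}) : \bar R :=
  if t is t'.+1 then
    \sum_(k < m | k \notin G)
      expD p (fun w => (~~ phi k w)%:R%:E) * log_weight t' (residual G k)
  else 1.

Lemma log_weight_ge0 t G : 0 <= log_weight t G.
Proof.
elim: t G => [//|t IH] G /=; apply: sume_ge0 => k _.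
by rewrite mule_ge0// expD_ge0// => w; rewrite lee_fin.
Qed.

(** By extremality, falsity of [k] already forces every other clause whose scope meets that of [k],
    so only the clauses with disjoint scope remain as a condition. *)
Lemma holds_first_false (G : {set 'I_m}) k x : k \notin G ->
  holds G x && first_false k x = ~~ phi k x && holds (residual G k) x.
Proof.
move=> kG; rewrite /first_false /holds; case: (boolP (phi k x)) => /= xk.
  by rewrite andbF.
apply/andP/forallP => [[/forallP hG /forallP hk] l|h].
  rewrite inE; apply/implyP => /andP[/orP[lG|lk] _].
    by have := hG l; rewrite lG.
  by have := hk l; rewrite lk.
(* Were [l] false together with [k], their scopes would be disjoint, so [l] would be in
   [residual G k], whose clauses hold. *)
have H l : (l \in G) || (l < k)%N -> phi l x.
  move=> lGk; apply: contraT => xl.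
  have kl : k != l.
    by apply: contraTneq lGk => <-; rewrite (negPf kG) ltnn.
  have := h l; rewrite inE lGk (disjoint_false_clauses _ _ _ kl xk xl) eqxx /=.
  by rewrite (negPf xl).
split; apply/forallP => l; apply/implyP => hl; apply: H; rewrite hl//.
exact: orbT.
Qed.

Lemma holds_residual_mix (G : {set 'I_m}) k x w :
  holds (residual G k) (mix (scp k) x w) = holds (residual G k) x.
Proof.
apply: eq_forallb => l; rewrite inE.
case: eqP => [dis|]; last by rewrite andbF.
by rewrite phi_mix_out.
Qed.

(* The factor of the law depending on the log splits off from the final state:
   resampling a false clause [k] forgets exactly the clauses meeting [scp k],
   which [~~ phi k] already implied. *)
Lemma expD_halt_exp t (G : {set 'I_m}) f : (forall x, 0 <= f x) ->
  expD p (fun x => (holds G x)%:R%:E * halt_exp t f x) =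
  log_weight t G * expD p (fun x => (Phi phi x)%:R%:E * f x).
Proof.
move=> f0; elim: t G => [|t IH] G.
  rewrite /= mul1e; apply: eq_expD => x.
  case: ifP => xP; last by rewrite mule0 mul0e.
  suff -> : holds G x by [].
  by apply/forallP => k; apply/implyP => _; move/forallP: xP.
have b0 (b : bool) : 0 <= b%:R%:E :> \bar R by rewrite lee_fin.
have h0 x : 0 <= halt_exp t f x by apply: halt_exp_ge0.
pose H k x := expD p (fun w => halt_exp t f (mix (scp k) x w)).
have H0 k x : 0 <= H k x by apply: expD_ge0.
(* Split by the first false clause, which is outside [G] whenever [holds G x]. *)
transitivity (\sum_(k < m | k \notin G) expD p (fun x =>
    (~~ phi k x)%:R%:E * ((holds (residual G k) x)%:R%:E * H k x))).
  rewrite -expD_sum//; last by move=> *; rewrite !mule_ge0.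
  apply: eq_expD => x /=; rewrite big_mkcond ge0_sume_distrr; last first.
    by move=> k _; case: ifP => // _; exact: H0.
  rewrite [RHS]big_mkcond; apply: eq_bigr => k _.
  case: (boolP (k \in G)) => kG /=.
    case: (boolP (holds G x)) => [/forallP/(_ k)|_]; last by rewrite mul0e.
    by rewrite kG /= => xk; rewrite /first_false xk mule0.
  have := holds_first_false G k x kG; rewrite muleA -EFinM -natrM mulnb => <-.
  by case: (holds G x) (first_false k x) => -[]; rewrite ?mul0e ?mul1e ?mule0.
rewrite /= ge0_sume_distrl; last first.
  by move=> k _; rewrite mule_ge0 ?log_weight_ge0 ?expD_ge0.
apply: eq_bigr => k kG; rewrite -muleA -IH.
(* Resample [scp k] using invariance: falsity of [k] then depends on the fresh [w] only and the
   other factors on [x] only, hence they are independent. *)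
transitivity (expD p (fun x => expD p (fun w =>
    (~~ phi k w)%:R%:E * ((holds (residual G k) x)%:R%:E * H k x)))).
  rewrite -[LHS](expD_mix p p_pmf (scp k)); last by move=> x; rewrite !mule_ge0.
  apply: eq_expD => x; apply: eq_expD => w.
  rewrite phi_mix_in holds_residual_mix; congr (_ * (_ * _)).
  apply: eq_expD => w'; congr (halt_exp t f _).
  by apply: assignP => i; rewrite !mixE; case: (i \in scp k).
transitivity (expD p (fun x => expD p (fun w => (~~ phi k w)%:R%:E) *
    ((holds (residual G k) x)%:R%:E * H k x))).
  apply: eq_expD => x; rewrite [RHS]muleC -expDZ//; last by rewrite mule_ge0.
  by apply: eq_expD => w; rewrite muleC.
rewrite expDZ//; [|by apply: expD_ge0|by move=> x; rewrite mule_ge0].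
(* Invariance once more: the resampling inside [H] is absorbed into the law of [x]. *)
congr (_ * _); rewrite -[RHS](expD_mix p p_pmf (scp k)); last first.
  by move=> x; rewrite mule_ge0.
apply: eq_expD => x; rewrite -expDZ//.
by apply: eq_expD => w; rewrite holds_residual_mix.
Qed.
End PartialRejectionSampling.

(** * Almost sure termination of the first-false rule *)

Section Termination.
Context {R : realType} {n m : nat} {T : 'I_n -> countType}.
Variables (p : forall i, T i -> R) (phi : 'I_m -> assign T -> bool).
Variable scp : 'I_m -> {set 'I_n}.
Hypothesis p_pmf : forall i, is_pmf (p i).
Hypothesis phi_scoped : well_scoped phi scp.
Hypothesis phi_extremal : extremal phi scp.
Implicit Types (x y w : assign T) (k l : 'I_m) (f : assign T -> \bar R).
Local Open Scope ereal_scope.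

Let D_ge0 x : 0 <= (prodD p x)%:E.
Proof. by rewrite lee_fin prodD_ge0. Qed.

Local Notation halt_exp := (halt_exp p phi scp).

Definition halt_prob x : \bar R := \esum_(t in [set: nat]) halt_exp t (fun=> 1) x.

Let halt_exp1_ge0 t x : 0 <= halt_exp t (fun=> 1) x.
Proof. exact: halt_exp_ge0. Qed.

Lemma esum_natS (a : nat -> \bar R) : (forall t, 0 <= a t) ->
  \esum_(t in [set: nat]) a t = a 0%N + \esum_(t in [set: nat]) a t.+1.
Proof.
move=> a0; rewrite (esumID [set 0%N])// setTI esum_set1//; congr (_ + _).
rewrite (reindex_esum setT _ S)//; split => //.
- by move=> t t' _ _ /= [].
- by case=> [|t] h; [case: h.2 | exists t].
Qed.

Lemma halt_prob_Phi x : Phi phi x -> 1 <= halt_prob x.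
Proof.
move=> xP; rewrite /halt_prob esum_natS//= xP leeDl//.
by apply: esum_ge0 => t _; exact: (halt_exp1_ge0 t.+1).
Qed.

(** The term for zero resamplings vanishes, and [halt_expS] allows any false clause as the first one
    resampled. *)
Lemma halt_prob_false k x : ~~ phi k x ->
  halt_prob x = expD p (fun w => halt_prob (mix (scp k) x w)).
Proof.
move=> xk; rewrite /halt_prob esum_natS// [X in X + _]/= (Phi_false _ k)// add0e.
rewrite expD_esum//; apply: eq_esum => t _.
exact: halt_expS.
Qed.

Lemma halt_prob_le1 x : halt_prob x <= 1.
Proof.
rewrite /halt_prob -nneseries_esumT//; apply: lime_le; first exact: is_cvg_nneseries.
(* Each partial sum is bounded by 1 uniformly in [x], by conditioning on the first resampling. *)
apply: nearW => N; elim: N x => [|N IH] x; first by rewrite big_geq.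
rewrite big_nat_recl//; have [xP|xP] := boolP (Phi phi x).
  rewrite big1 => [|t _]; first by rewrite adde0 /= xP.
  exact: halt_expS_Phi.
have [k /andP[xk _]] := exists_first_false _ _ xP.
rewrite [X in X + _]/= (negPf xP) add0e.
under eq_bigr => t _ do rewrite (halt_expS _ _ _ _ _ _ _ _ k)//.
rewrite -expD_sum// -[leRHS](expD_cst p p_pmf)//.
exact: le_expD.
Qed.

(* Resampling every violated clause to the values of [sg] makes the number of
   coordinates disagreeing with [sg] drop at each step. *)
Lemma halt_prob_lower (sg : assign T) (s : R) (d : nat) x :
  Phi phi sg -> (0 <= s <= 1)%R -> (forall y, (1 - s)%:E <= halt_prob y) ->
  (#|[pred i | x i != sg i]| <= d)%N ->
  (1 - s + s * prodD p sg ^+ d)%:E <= halt_prob x.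
Proof.
move=> sgP /andP[s0 s1] hs.
have de0 : (0 <= prodD p sg)%R by apply: prodD_ge0.
have de1 : (prodD p sg <= 1)%R.
  rewrite -lee_fin -(expD_cst p p_pmf 1)// /expD.
  under eq_esum => w _ do rewrite mule1.
  exact: (esum_ge_term _ (fun w => (prodD p w)%:E)).
(* The target is at most 1, which settles every satisfying [x]. *)
have bound e : (1 - s + s * prodD p sg ^+ e <= 1)%R.
  by rewrite -lerBrDl opprB addrC subrK ler_piMr// exprn_ile1.
elim: d x => [|d IH] x.
  rewrite leqn0 => /eqP /card0_eq e; rewrite (_ : x = sg).
    by apply: le_trans (halt_prob_Phi _ sgP); rewrite lee_fin.
  by apply: assignP => i; have := e i; rewrite inE => /negbFE/eqP.
move=> xd; have [xP|xP] := boolP (Phi phi x).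
  by apply: le_trans (halt_prob_Phi _ xP); rewrite lee_fin.
have [k /andP[xk _]] := exists_first_false _ _ xP.
rewrite (halt_prob_false k)//.
have sd0 : (0 <= s * prodD p sg ^+ d)%R by rewrite mulr_ge0 ?exprn_ge0.
(* If the fresh sample is [sg] itself, the induction hypothesis applies; for any other sample the
   uniform bound [1 - s] is used. *)
pose g w := (1 - s)%:E + (if w == sg then (s * prodD p sg ^+ d)%:E else 0).
apply: (@le_trans _ _ (expD p g)); last first.
  apply: le_expD => // w; rewrite /g; case: eqP => [->|_]; last by rewrite adde0.
  rewrite -EFinD; apply: IH; rewrite -ltnS; apply: leq_trans xd.
  apply: proper_card; apply/properP; split.
    apply/fintype.subsetP => i; rewrite !inE mixE.
    by case: (i \in scp k) => //; rewrite eqxx.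
  (* Agreement with [sg] on all of [scp k] would make [phi k x] true. *)
  have [i /andP[ik xi]] : exists i, (i \in scp k) && (x i != sg i).
    apply/existsP; apply: contraNT xk => /existsPn h.
    rewrite (phi_scoped.2 k x sg) => [|i ik]; first exact: (forallP sgP).
    by have := h i; rewrite ik /= negbK => /eqP.
  by exists i; rewrite !inE// mixE ik eqxx.
rewrite expDD//; first last.
  by move=> w; case: ifP.
  by move=> w; rewrite lee_fin subr_ge0.
rewrite expD_cst ?lee_fin ?subr_ge0// EFinD; apply: leeD => //.
rewrite exprS mulrCA EFinM.
have := esum_ge_term setT (fun w => (prodD p w)%:E *
  (if w == sg then (s * prodD p sg ^+ d)%:E else 0)) sg.
rewrite eqxx; apply => // w _; rewrite mule_ge0//.
by case: ifP.
Qed.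

(** The infimum [1 - s] of the halting probabilities improves itself: [halt_prob_lower] gives
    [1 - s + s * e <= 1 - s] with [e > 0], whence [s <= 0]. *)
Lemma halt_prob_eq1 x : 0 < probPhi p phi -> halt_prob x = 1.
Proof.
move=> Pp; have [sg sgP sgp] : exists2 sg, Phi phi sg & (0 < prodD p sg)%R.
  apply: contrapT => h; move: Pp; rewrite /probPhi esum1 ?ltxx// => y yP.
  apply/eqP; rewrite eqe eq_le prodD_ge0// andbT leNgt.
  by apply/negP => yp; apply: h; exists y.
pose r := ereal_inf (range halt_prob).
have rle y : r <= halt_prob y by apply: ereal_inf_lbound; exists y.
have r0 : 0 <= r.
  apply: le_ereal_inf_tmp => _ [y _ <-]; exact: esum_ge0.
have r1 : r <= 1 := le_trans (rle x) (halt_prob_le1 x).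
have rfin : r \is a fin_num by rewrite ge0_fin_numE// (le_lt_trans r1)// ltry.
(* The exponent [n] bounds the number of coordinates on which any assignment differs from [sg]. *)
pose s := (1 - fine r)%R; pose e := (prodD p sg ^+ n)%R.
have sr : (1 - s)%:E = r by rewrite opprB addrC subrK fineK.
have s01 : (0 <= s <= 1)%R.
  by rewrite subr_ge0 lerBlDr lerDl fine_ge0// andbT -lee_fin fineK.
have : (1 - s + s * e)%:E <= r.
  apply: le_ereal_inf_tmp => _ [y _ <-]; apply: halt_prob_lower => //.
    by move=> z; rewrite sr.
  by rewrite -[leqRHS](card_ord n) max_card.
rewrite -sr lee_fin gerDl pmulr_lle0 ?exprn_gt0// => s0.
apply/eqP; rewrite eq_le halt_prob_le1/= (le_trans _ (rle x))//.
by rewrite -sr lee_fin lerBrDr gerDl.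
Qed.
End Termination.

(** * Reduction of weighted histories under an arbitrary rule to the first-false rule *)

Section Histories.
Context {R : realType} {n m : nat} {T : 'I_n -> countType}.
Variables (p : forall i, T i -> R) (phi : 'I_m -> assign T -> bool).
Variable scp : 'I_m -> {set 'I_n}.
Variable sel : assign T -> seq ('I_m * assign T) -> 'I_m -> R.
Hypothesis p_pmf : forall i, is_pmf (p i).
Hypothesis phi_scoped : well_scoped phi scp.
Hypothesis phi_extremal : extremal phi scp.
Hypothesis sel_valid : valid_rule phi sel.
Implicit Types (x y w : assign T) (k l : 'I_m) (f : assign T -> \bar R).
Local Open Scope ereal_scope.

Local Notation halt_exp := (halt_exp p phi scp).
Local Notation histw := (histw p phi scp sel).

Let D_ge0 x : 0 <= (prodD p x)%:E.
Proof. by rewrite lee_fin prodD_ge0. Qed.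

Lemma resample_ge0 A x y : (0 <= resample p A x y)%R.
Proof. by rewrite mulr_ge0// prodr_ge0// => i _; case: (p_pmf i). Qed.

Lemma histw_ge0 x0 s : (0 <= histw x0 s)%R.
Proof.
elim: s => [|[k y] s IH] /=; first exact: prodD_ge0.
by rewrite mulr_ge0// mulr_ge0 ?resample_ge0// mulr_ge0//; apply sel_valid.1.
Qed.

Let histw0 x0 s : 0 <= (histw x0 s)%:E.
Proof. by rewrite lee_fin histw_ge0. Qed.

Lemma esum_fin (I : finType) (a : I -> \bar R) : (forall i, 0 <= a i) ->
  \esum_(i in [set: I]) a i = \sum_(i : I) a i.
Proof.
move=> a0; rewrite esum_fset//; last exact: finite_finset.
rewrite (fsbigE (index_enum I)) ?index_enum_uniq// => [|i _]; last by rewrite mem_index_enum.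
by apply: eq_bigl => i; rewrite in_setT.
Qed.

(** By [halt_expS] all false clauses yield the same value, so the selection probabilities factor out
    and sum to 1; if [Phi] holds, both sides are 0. *)
Lemma esum_step x0 s t f : (forall x, 0 <= f x) ->
  \esum_(ky in [set: 'I_m * assign T])
    (((~~ Phi phi (cur x0 s))%:R * sel x0 s ky.1 *
      resample p (scp ky.1) (cur x0 s) ky.2)%:E * halt_exp t f ky.2) =
  halt_exp t.+1 f (cur x0 s).
Proof.
move=> f0; have [sel0 [sel1 selF]] := sel_valid.
have H0 := halt_exp_ge0 p phi scp p_pmf t f.
have [xP|xP] := boolP (Phi phi (cur x0 s)).
  rewrite halt_expS_Phi// esum1// => ky _.
  by rewrite !mul0r mul0e.
set x := cur x0 s in xP *.
transitivity (\esum_(k in [set: 'I_m]) \esum_(y in [set: assign T])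
    ((sel x0 s k)%:E * ((resample p (scp k) x y)%:E * halt_exp t f y))).
  rewrite (@esum_esum _ _ _ setT (fun=> setT) (fun k y => (sel x0 s k)%:E *
    ((resample p (scp k) x y)%:E * halt_exp t f y))); last first.
    by move=> k y _ _; rewrite !mule_ge0 ?lee_fin ?resample_ge0// H0.
  rewrite (_ : setT `*`` _ = setT); last by apply/seteqP; split.
  by apply: eq_esum => -[k y] _ /=; rewrite mul1r EFinM muleA.
under eq_esum => k _.
  rewrite esumZl ?lee_fin//; last first.
    by move=> y _; rewrite mule_ge0 ?lee_fin ?resample_ge0// H0.
  rewrite esum_resample//; last by move=> y; exact: H0.
  over.
rewrite esum_fin; last first.
  by move=> k; rewrite mule_ge0 ?lee_fin// expD_ge0// => w; exact: H0.
transitivity (\sum_(k < m) (sel x0 s k)%:E * halt_exp t.+1 f x).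
  apply: eq_bigr => k _; have [xk|xk] := boolP (phi k x).
    by rewrite selF// !mul0e.
  by congr (_ * _); symmetry; exact: halt_expS.
rewrite -ge0_sume_distrl; last by move=> k _; rewrite lee_fin.
by rewrite sumEFin sel1// mul1e.
Qed.

(** Iterations under [sel] are traded one by one, latest first, for iterations of the first-false
    rule; [r] counts those already traded. *)
Lemma esum_histw_size t r f : (forall x, 0 <= f x) ->
  \esum_(x0 in [set: assign T]) \esum_(s in [set s | size s = t])
    ((histw x0 s)%:E * halt_exp r f (cur x0 s)) =
  expD p (halt_exp (t + r) f).
Proof.
move=> f0; elim: t r => [|t IH] r.
  apply: eq_esum => x0 _; rewrite (_ : [set s | _] = [set [::]]).
    by rewrite esum_set1// mule_ge0// halt_exp_ge0.
  by apply/seteqP; split => [s /size0nil|_ ->].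
rewrite addSnnS -IH; apply: eq_esum => x0 _.
rewrite (reindex_esum ([set s | size s = t] `*`` (fun=> [set: 'I_m * assign T])) _
  (fun c => c.2 :: c.1)); last first.
  split => /=.
  - by move=> [s ky] /= [-> _].
  - by move=> [s ky] [s' ky'] _ _ /= [-> ->].
  - by move=> [|ky s] //= [st]; exists (s, ky).
rewrite -(@esum_esum _ _ _ _ (fun=> setT) (fun s ky =>
  (histw x0 (ky :: s))%:E * halt_exp r f ky.2)); last first.
  by move=> s ky _ _; rewrite mule_ge0// halt_exp_ge0.
apply: eq_esum => s _; rewrite -esum_step// -esumZl//; last first.
  move=> [k y] _ /=; rewrite mule_ge0 ?halt_exp_ge0// lee_fin.
  by rewrite mulr_ge0 ?resample_ge0// mulr_ge0//; apply sel_valid.1.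
by apply: eq_esum => -[k y] _ /=; rewrite EFinM muleA.
Qed.

(** Common form of [haltProb] (constant 1) and [termProb] (indicator of a point). *)
Definition term_exp f : \bar R :=
  \esum_(h in [set h : history T m | Phi phi (cur h.1 h.2)])
    ((histw h.1 h.2)%:E * f (cur h.1 h.2)).

Lemma term_expE f : (forall x, 0 <= f x) ->
  term_exp f = \esum_(t in [set: nat]) expD p (halt_exp t f).
Proof.
move=> f0; rewrite /term_exp esum_mkcond.
(* [halt_exp 0 f] is [f] cut off outside [Phi], so it encodes the halting condition and the sum can
   be sorted by history length. *)
pose a (h : history T m) := (histw h.1 h.2)%:E * halt_exp 0 f (cur h.1 h.2).
pose J (t : nat) := [set h : history T m | size h.2 = t].
transitivity (\esum_(h in \bigcup_(t in [set: nat]) J t) a h).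
  rewrite (_ : \bigcup_(t in _) _ = setT); last first.
    by apply/seteqP; split => // h _; exists (size h.2).
  apply: eq_esum => h _; rewrite /a /=.
  case: (boolP (Phi phi (cur h.1 h.2))) => hP; first by rewrite mem_set.
  by rewrite mule0 memNset//; apply/negP.
rewrite esum_bigcupT.
- apply: eq_esum => t _; rewrite -[in RHS](addn0 t) -esum_histw_size//.
  rewrite (@esum_esum _ _ _ setT (fun=> [set s | size s = t])
    (fun x0 s => (histw x0 s)%:E * halt_exp 0 f (cur x0 s))).
    rewrite (_ : _ `*`` _ = J t)//.
    by apply/seteqP; split => [[x s] []|[x s] //].
  by move=> x0 s _ _; rewrite mule_ge0// halt_exp_ge0.
- apply/trivIsetP => t t' _ _ tt'; rewrite -subset0 => h [ht ht'].
  by move: tt'; rewrite -ht -ht' eqxx.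
- by move=> h; rewrite mule_ge0// halt_exp_ge0.
Qed.

Lemma expD_Phi f : expD p (fun x => (Phi phi x)%:R%:E * f x) =
  \esum_(x in [set x | Phi phi x]) ((prodD p x)%:E * f x).
Proof.
rewrite [RHS]esum_mkcond; apply: eq_esum => x _.
case: (boolP (Phi phi x)) => xP; first by rewrite mem_set// mul1e.
by rewrite mul0e mule0 memNset//; apply/negP.
Qed.

Lemma probPhi_fin_num : probPhi p phi \is a fin_num.
Proof.
have P0 : 0 <= probPhi p phi by apply: esum_ge0.
rewrite ge0_fin_numE// (@le_lt_trans _ _ 1) ?ltry//.
rewrite -(expD_cst p p_pmf 1)//.
rewrite /probPhi esum_mkcond; apply: le_esum => x _.
by case: ifP => // _; rewrite mule1.
Qed.

(** [expD_halt_exp] with empty [G] gives a factor [C] independent of [f]; almost sure termination,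
    the case where [f] is 1, determines [C]. *)
Lemma term_exp_Phi f : (forall x, 0 <= f x) -> 0 < probPhi p phi ->
  term_exp f =
  (fine (probPhi p phi))^-1%:E * \esum_(x in [set x | Phi phi x]) ((prodD p x)%:E * f x).
Proof.
move=> f0 P0; pose C := \esum_(t in [set: nat]) log_weight p phi scp t finset.set0.
have E g : (forall x, 0 <= g x) -> term_exp g =
    C * \esum_(x in [set x | Phi phi x]) ((prodD p x)%:E * g x).
  move=> g0; rewrite term_expE// -expD_Phi muleC -esumZl; first last.
    by move=> t _; exact: log_weight_ge0.
    by apply: expD_ge0 => // x; rewrite mule_ge0// lee_fin.
  apply: eq_esum => t _; rewrite muleC -expD_halt_exp//.
  apply: eq_expD => x; rewrite (_ : holds _ _ _) ?mul1e//.
  by apply/forallP => k; rewrite finset.in_set0.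
rewrite E//; congr (_ * _).
have P1 : \esum_(x in [set x | Phi phi x]) ((prodD p x)%:E * 1) = probPhi p phi.
  by apply: eq_esum => x _; rewrite mule1.
have Pfin := probPhi_fin_num.
have := E (fun=> 1) (fun=> lee01); rewrite P1 term_expE//.
rewrite -expD_esum//; last by move=> *; exact: halt_exp_ge0.
rewrite (eq_expD _ _ (fun=> 1)); last first.
  by move=> x; apply: halt_prob_eq1.
rewrite expD_cst// -(fineK Pfin).
have p0 : (0 < fine (probPhi p phi))%R by rewrite fine_gt0// P0 -ge0_fin_numE ?ltW.
have C0 : 0 <= C by apply: esum_ge0 => t _; exact: log_weight_ge0.
(* An infinite [C] would make the total mass infinite instead of 1. *)
clear E; case: C C0 => [c _ []|_|//]; last by rewrite gt0_mulye ?lte_fin.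
by move=> e; congr EFin; rewrite -[LHS](mulfK (lt0r_neq0 p0)) -e mul1r.
Qed.

End Histories.

Theorem theorem1 (R : realType) (n m : nat) (T : 'I_n -> countType)
  (p : forall i : 'I_n, T i -> R)
  (phi : 'I_m -> assign T -> bool) (scp : 'I_m -> {set 'I_n}) :
  (forall i, is_pmf (p i)) ->
  well_scoped phi scp ->
  extremal phi scp ->
  (0 < probPhi p phi)%E ->
  forall sel : assign T -> seq ('I_m * assign T) -> 'I_m -> R,
  valid_rule phi sel ->
  haltProb p phi scp sel = 1%E /\
  (forall x : assign T, termProb p phi scp sel x = (condD p phi x)%:E).
Proof.
move=> p_pmf ws ext P0 sel vs; split.
  transitivity (term_exp p phi scp sel (fun=> 1%E)).
    by apply: eq_esum => h _; rewrite mule1.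
  rewrite term_exp_Phi//; under eq_esum => x _ do rewrite mule1.
  have Pfin := probPhi_fin_num p phi p_pmf.
  rewrite -/(probPhi p phi) -[X in (_ * X)%E](fineK Pfin) -EFinM mulVf//.
  by rewrite gt_eqF// fine_gt0// P0 -ge0_fin_numE// ltW.
(* The law at [x] is the expectation of the indicator of [x]. *)
move=> x; transitivity (term_exp p phi scp sel (fun y => (y == x)%:R%:E)).
  rewrite /termProb /term_exp esum_mkcond [RHS]esum_mkcond.
  apply: eq_esum => h _; case: (boolP (Phi phi (cur h.1 h.2))) => hP; last first.
    by rewrite !memNset//= => [|[]]; rewrite (negPf hP).
  rewrite [in RHS]mem_set//; have [hx|hx] := eqVneq (cur h.1 h.2) x.
    by rewrite mem_set// mule1.
  by rewrite memNset ?mule0// => -[_ e]; rewrite e eqxx in hx.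
rewrite term_exp_Phi//.
rewrite (_ : esum _ _ = (prodD p x * (Phi phi x)%:R)%:E).
  by rewrite -EFinM mulrC.
rewrite esum_mkcond -(@esum_set1 _ _ x (fun y => (prodD p y * (Phi phi y)%:R)%:E)); last first.
  by rewrite lee_fin mulr_ge0 ?prodD_ge0.
rewrite [RHS]esum_mkcond; apply: eq_esum => y _.
have [->|yx] := eqVneq y x; last first.
  by rewrite mule0 if_same memNset//; exact/eqP.
rewrite [in RHS]mem_set// mule1; case: (boolP (Phi phi x)) => xP.
  by rewrite mem_set// mulr1.
by rewrite mulr0 memNset//; exact/negP.
Qed.
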